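(* Let $Q,R\in\mathbb{C}_n[t]$. Let $f$ and $g$ be continuous functions $[0,1] \to \mathbb{R}$ satisfying $f(0) = g(1) = 1$ and $f(1) = g(0) = 0$, and such that $\mathcal{P}_\alpha = f(\alpha)Q+g(\alpha)R$ is a polynomial path from $Q$ to $R$ (in particular $\mathcal{P}_\alpha$ is monic of degree $n$ for every $\alpha\in[0,1]$). If $\max\{f(\alpha),g(\alpha)\} \geq 0$ for all $\alpha \in [0,1]$, then any convex root-pairing $p:\Sigma(Q)\to\Sigma(R)$ is also a $\mathcal{P}$-root-pairing.
   Context: $\mathbb{C}_n[t]$ is the set of monic univariate complex polynomials of degree $n$. A polynomial path is a continuous function $\mathcal{P}:[0,1]\to\mathbb{C}_n[t]$ (continuity of the coefficients), with value $\mathcal{P}_\alpha$ at $\alpha$; it is a path from $\mathcal{P}_0$ to $\mathcal{P}_1$. $\Sigma(Q)$ denotes the size-$n$ multiset of roots of a degree-$n$ polynomial $Q$ (with multiplicity). A $\mathcal{P}$-root-path set is a multiset $\{\gamma_1,\ldots,\gamma_n\}$ of continuous functions $[0,1]\to\mathbb{C}$ such that $\Sigma(\mathcal{P}_\alpha)=\{\gamma_1(\alpha),\ldots,\gamma_n(\alpha)\}$ as multisets for all $\alpha\in[0,1]$. With $Q=\mathcal{P}_0$, $R=\mathcal{P}_1$, a $\mathcal{P}$-root-pairing is a bijection $\Sigma(Q)\to\Sigma(R)$ induced by some $\mathcal{P}$-root-path set via $\gamma_j(0)\mapsto\gamma_j(1)$, $j=1,\ldots,n$; different copies of a repeated root are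 regarded as distinct elements of the multiset. A convex root-pairing of $Q$ and $R$ is a root-pairing for the convex polynomial path $\alpha\mapsto(1-\alpha)Q+\alpha R$. *)

(* Defs.v *)
From HB Require Import structures.
From mathcomp Require Export all_boot all_order all_algebra.
From mathcomp Require Export all_classical all_reals all_analysis.
From mathcomp Require Export finmap multiset.
From mathcomp Require Export complex.

Set Implicit Arguments.
Unset Strict Implicit.
Unset Printing Implicit Defensive.

Import Order.TTheory GRing.Theory Num.Theory numFieldNormedType.Exports.

Local Open Scope classical_set_scope.
Local Open Scope complex_scope.
Local Open Scope ring_scope.

Definition monic_deg (K : realType) (n : nat) (P : {poly K[i]}) : Prop :=
  P \is monic /\ size P = n.+1.

(* Paths are total functions on [K]; only their values on [0, 1] matter.
   The alias [K[i]^o] selects the norm topology of the field [K[i]]. *)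
Definition poly_path (K : realType) (n : nat) (P : K -> {poly K[i]}) : Prop :=
  (forall a : K, a \in `[0, 1] -> monic_deg n (P a)) /\
  (forall k : nat,
     {within `[0, 1], continuous (fun a : K => (P a)`_k : K[i]^o)}).

Definition poly_path_from_to (K : realType) (n : nat)
    (P : K -> {poly K[i]}) (Q R : {poly K[i]}) : Prop :=
  [/\ poly_path n P, P 0 = Q & P 1 = R].

(* [closed_field_poly_normal P] is a sequence of roots [r] such that
   [P = lead_coef P *: \prod_(z <- r) ('X - z%:P)]. *)
Definition Sigma (K : realType) (P : {poly K[i]}) : multiset K[i] :=
  seq_mset (sval (closed_field_poly_normal P)).

Lemma SigmaE (K : realType) (P : {poly K[i]}) (z : K[i]) :
  P != 0 -> Sigma P z = mup z P.
Proof.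
move=> P0; rewrite /Sigma mset_seqE.
case: closed_field_poly_normal => r /= Pr.
have lP0 : lead_coef P != 0 by rewrite lead_coef_eq0.
by rewrite [in RHS]Pr -mul_polyC mupMr ?mu_prod_XsubC ?rootC.
Qed.

(* The elements of a multiset, with the copies of a repeated element regarded
   as distinct: the pair [(z, k)], [k < A z], is the [k]-th copy of [z]. *)
Definition copies (T : choiceType) (A : multiset T) : Type :=
  {z : T & 'I_(A z)}.

Definition root_path_set (K : realType) (n : nat) (P : K -> {poly K[i]})
    (gamma : 'I_n -> K -> K[i]) : Prop :=
  (forall j : 'I_n, {within `[0, 1], continuous (gamma j : K -> K[i]^o)}) /\
  (forall a : K, a \in `[0, 1] ->
     Sigma (P a) = seq_mset [seq gamma j a | j : 'I_n]).

(* [s] and [t] identify the starting (resp. ending) points of the [n] paths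
   with the [n] elements of [Sigma Q] (resp. [Sigma R]).  Nothing distinguishes
   the copies of a repeated root, so any such identification is allowed. *)
Definition root_pairing (K : realType) (n : nat) (P : K -> {poly K[i]})
    (Q R : {poly K[i]}) (p : copies (Sigma Q) -> copies (Sigma R)) : Prop :=
  [/\ poly_path_from_to n P Q R,
      bijective p &
      exists gamma : 'I_n -> K -> K[i],
        root_path_set P gamma /\
        exists (s : 'I_n -> copies (Sigma Q)) (t : 'I_n -> copies (Sigma R)),
          [/\ bijective s, bijective t &
              forall j : 'I_n, [/\ tag (s j) = gamma j 0,
                                   tag (t j) = gamma j 1 &
                                   p (s j) = t j]]].

Definition convex_path (K : realType) (Q R : {poly K[i]}) (a : K) :
  {poly K[i]} := (1 - a)%:C *: Q + a%:C *: R.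

Definition convex_root_pairing (K : realType) (n : nat) (Q R : {poly K[i]})
    (p : copies (Sigma Q) -> copies (Sigma R)) : Prop :=
  root_pairing n (convex_path Q R) p.

(* Main.v *)
(* Comparing leading coefficients gives f + g = 1 on [0, 1], so the path is
   a |-> L (g a) where L is the line b |-> (1 - b) Q + b R.  The values of g
   may leave [0, 1], so root paths gamma_j of L on [0, 1] must be continued to
   root paths Gamma_j of L on the whole real line; the Gamma_j \o g then have
   the same endpoints as the gamma_j.

   For the continuation, a continuous family P of monic polynomials on
   [0, +oo[ has a continuous root starting at any given root of P 0.  With mesh
   1 / (N + 1), jump from a root at each grid point to a nearest root at the
   next one.  For b near a, all roots of P b lie near the n roots of P a, and a
   chain with small jumps staying near n points cannot travel far, so these
   step functions are asymptotically equicontinuous.  Their limit along an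
   ultrafilter is a continuous root.  Dividing by the corresponding linear
   factor leaves a continuous family, and induction on the degree concludes. *)
Require Import Defs.
From mathcomp Require Import all_boot all_order all_algebra.
From mathcomp Require Import all_classical all_reals all_analysis complex.
From mathcomp Require Import zify ring lra.

Set Implicit Arguments.
Unset Strict Implicit.
Unset Printing Implicit Defensive.

Import Order.TTheory GRing.Theory Num.Theory numFieldNormedType.Exports.

Local Open Scope classical_set_scope.
Local Open Scope complex_scope.
Local Open Scope ring_scope.

(** * Distances to roots, clusters and root bounds *)

Lemma horner_prod_XsubC (F : comNzRingType) (rs : seq F) z :
  (\prod_(r <- rs) ('X - r%:P)).[z] = \prod_(r <- rs) (z - r).
Proof. by rewrite horner_prod; apply: eq_bigr => r _; rewrite hornerXsubC. Qed.

(** The least factor is at most the geometric mean: otherwise multiplying over all roots would give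
    [q ^+ size rs < q ^+ size rs]. *)
Lemma exists_close_factor (F : numDomainType) (rs : seq F) (z : F) :
  rs != [::] ->
  exists2 r, r \in rs &
    `|z - r| ^+ size rs <= `|(\prod_(r <- rs) ('X - r%:P)).[z]|.
Proof.
rewrite horner_prod_XsubC normr_prod; set q := \prod_(r <- rs) `|_| => rs0.
have q_ge0 : 0 <= q by rewrite prodr_ge0.
apply: contrapT => far.
suff : \prod_(r <- rs) q < \prod_(r <- rs) `|z - r| ^+ size rs.
  by rewrite prodrXl big_const_seq count_predT iter_mulr_1 ltxx.
rewrite big_seq [ltRHS]big_seq ltr_prod //.
  apply/hasP; case: rs rs0 {q q_ge0 far} => // r rs _.
  by exists r; rewrite ?mem_head.
move=> r rrs; rewrite q_ge0 real_ltNge ?rpredX ?normr_real ?ger0_real //.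
by apply/negP => near; apply: far; exists r.
Qed.

(** Each centre costs at most [3 e]: [2 e] from the first point to the last visit to its disc, and
    [e] for the jump that leaves the disc for good. The bound is independent of the number of steps
    [b - a]. *)
Lemma dist_le_clusters (F : numDomainType) (V : normedZmodType F)
    (x : nat -> V) (cs : seq V) (e : F) (a b : nat) :
  (a <= b)%N ->
  (forall k, (a <= k <= b)%N -> exists2 c, c \in cs & `|x k - c| <= e) ->
  (forall k, (a <= k < b)%N -> `|x k.+1 - x k| <= e) ->
  `|x b - x a| <= e *+ (3 * size cs).
Proof.
have [m] := ubnP (size cs); elim: m cs a => // m IHm cs a szcs ab near_cs step.
have [|c ccs xac] := near_cs a; first by rewrite leqnn.
have e_ge0 : 0 <= e by rewrite (le_trans _ xac).
(* After its last visit [l] to the disc around [c], the sequence stays near the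
   other points of [cs]. *)
pose close k := [&& (a <= k)%N, (k <= b)%N & `|x k - c| <= e].
have close_a : exists k, close k by exists a; rewrite /close leqnn ab xac.
have close_b k : close k -> (k <= b)%N by case/and3P.
case: (ex_maxnP close_a close_b) => l /and3P[al lb xlc] lmax.
have xla : `|x l - x a| <= e *+ 2.
  rewrite -(subrKA c) mulr2n (le_trans (ler_normD _ _)) // lerD //.
  by rewrite distrC.
have cs_gt0 : (0 < size cs)%N by case: cs ccs {near_cs szcs}.
have [lb'|bl] := ltnP l b; last first.
  have -> : b = l by apply/eqP; rewrite eqn_leq bl lb.
  by rewrite (le_trans xla) // ler_wpMn2l // mulnC; case: (size cs) cs_gt0.
pose cs' := [seq c' <- cs | c' != c].
have szcs' : (size cs' < size cs)%N.
  rewrite size_filter -(count_predC (pred1 c) cs) -[X in (X < _)%N]add0n.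
  by rewrite ltn_add2r -has_count has_pred1.
have xbl : `|x b - x l.+1| <= e *+ (3 * size cs').
  apply: IHm => //; first exact: leq_trans szcs' _.
  - move=> k /andP[lk kb]; have [|c' c'cs xkc'] := near_cs k.
      by rewrite kb (leq_trans al) // ltnW.
    exists c' => //; rewrite mem_filter c'cs andbT /=; apply/eqP => c'c.
    have /lmax : close k by rewrite /close kb -c'c xkc' (leq_trans al) // ltnW.
    by rewrite leqNgt lk.
  - by move=> k /andP[lk kb]; rewrite step // kb (leq_trans al) // ltnW.
rewrite -(subrKA (x l.+1)) (le_trans (ler_normD _ _)) //.
rewrite -(subrKA (x l) (x l.+1)).
have xll : `|x l.+1 - x l| <= e by rewrite step // al.
apply: (@le_trans _ _ (e *+ (3 * size cs') + e *+ 3)).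
  rewrite lerD // mulrS (le_trans (ler_normD _ _)) // lerD //.
by rewrite -mulrnDr ler_wpMn2l // addnC -mulnS leq_mul2l szcs'.
Qed.

(** If [|z| > 1], divide $z^n = -\sum_{k<n} p_k z^k$ by $z^{n-1}$: the powers left on the right have
    modulus at most 1. *)
Lemma monic_root_bound (F : numDomainType) (p : {poly F}) n z :
  p \is monic -> size p = n.+1 -> root p z ->
  `|z| <= 1 + \sum_(k < n) `|p`_k|.
Proof.
move=> /monicP; rewrite lead_coefE => pn1 szp /rootP; rewrite horner_coef szp.
rewrite szp /= in pn1.
rewrite big_ord_recr /= pn1 mul1r => pz0.
have [z1|z1] := real_leP (normr_real z) (real1 F).
  by rewrite (le_trans z1) // lerDl sumr_ge0.
case: n => [|n] in szp pn1 pz0 *.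
  by move/eqP: pz0; rewrite big_ord0 add0r expr0 oner_eq0.
have z0 : 0 < `|z| by rewrite (lt_trans _ z1) ?ltr01.
rewrite -[leLHS]add0r lerD ?ler01 // -(ler_pM2r (exprn_gt0 n z0)).
rewrite -exprS -normrX.
have /eqP := pz0; rewrite addrC addr_eq0 => /eqP->; rewrite normrN.
rewrite (le_trans (ler_norm_sum _ _ _)) // mulr_suml ler_sum // => k _.
by rewrite normrM ler_wpM2l // normrX ler_weXn2l ?ltW // -ltnS.
Qed.

(** * Continuous families of monic polynomials *)

(** Unlike in [poly_path], the conditions hold on a whole space, so that the family can be composed
    with any continuous map. *)
Definition monic_path (C : numFieldType) (K : topologicalType) n
    (P : K -> {poly C}) :=
  (forall a, P a \is monic /\ size (P a) = n.+1) /\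
  (forall k, continuous (fun a => (P a)`_k)).

Lemma near_root_bound (C : numFieldType) (K : topologicalType) n
    (P : K -> {poly C}) (a : K) :
  monic_path n P ->
  exists B, \forall b \near a, forall z, root (P b) z -> `|z| <= B.
Proof.
move=> [mP cP]; exists (1 + \sum_(k < n) (1 + `|(P a)`_k|)).
have : \forall b \near a, forall k : 'I_n, `|(P a)`_k - (P b)`_k| < 1.
  by apply: filter_forall => k; apply/cvgr_dist_lt; [exact: cP|].
apply: filterS => b Pab z rz; have [mPb szb] := mP b.
rewrite (le_trans (monic_root_bound mPb szb rz)) // lerD2l ler_sum // => k _.
rewrite -lerBlDr (le_trans (lerB_dist _ _)) // distrC ltW //.
Qed.

Lemma near_horner (C : numFieldType) (K : topologicalType) n
    (P : K -> {poly C}) (a : K) (B e : C) :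
  monic_path n P -> 0 < e ->
  \forall b \near a, forall z, `|z| <= B -> `|(P a).[z] - (P b).[z]| < e.
Proof.
(* The summand 1 keeps [D] positive and makes the final inequality strict; [|B|] is used because [B]
   is an arbitrary scalar. *)
move=> [mP cP] e0; pose D := 1 + \sum_(k < n.+1) `|B| ^+ k.
have D0 : 0 < D by rewrite ltr_pwDl ?sumr_ge0 // => k _; rewrite exprn_ge0.
have : \forall b \near a, forall k : 'I_n.+1, `|(P a)`_k - (P b)`_k| < e / D.
  apply: filter_forall => k; apply/cvgr_dist_lt; first exact: cP.
  by rewrite divr_gt0.
apply: filterS => b Pab z zB; have [_ sza] := mP a; have [_ szb] := mP b.
rewrite !horner_coef sza szb -sumrB (le_lt_trans (ler_norm_sum _ _ _)) //.
have eD : e = e / D * D by rewrite divfK // gt_eqF.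
rewrite [ltRHS]eD mulrDr mulr1 mulr_sumr -[ltLHS]add0r ltr_leD ?divr_gt0 //.
rewrite ler_sum // => k _; rewrite -mulrBl normrM ler_pM //; first exact: ltW.
rewrite normrX lerXn2r ?nnegrE // (le_trans zB) // real_ler_norm //.
by rewrite ger0_real // (le_trans _ zB).
Qed.

(** Roots of [P b] are bounded uniformly for [b] near [a]; on that disc both [P b] and [P c] are
    within [e / 2] of [P a]. *)
Lemma near_root_horner (C : numFieldType) (K : topologicalType) n
    (P : K -> {poly C}) (a : K) (e : C) :
  monic_path n P -> 0 < e ->
  \forall b \near a & c \near a,
    forall z, root (P b) z -> `|(P c).[z]| < e.
Proof.
move=> mP e0; have [B nearB] := near_root_bound a mP.
have e20 : 0 < e / 2 by rewrite divr_gt0 // ltr0n.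
have nearH := near_horner a B mP e20.
near=> b c => z rz.
have zB : `|z| <= B by apply: (near nearB b).
rewrite -[(P c).[z]]subr0 -(rootP rz) -(subrKA (P a).[z]).
rewrite (le_lt_trans (ler_normD _ _)) // (splitr e) ltrD //.
  by rewrite distrC; apply: (near nearH c).
by apply: (near nearH b).
Unshelve. all: by end_near. Qed.

(** * Chains of roots along a grid *)

Lemma monic_prod_roots (C : closedFieldType) (p : {poly C}) n :
  p \is monic -> size p = n.+1 ->
  exists2 rs : seq C, p = \prod_(r <- rs) ('X - r%:P) & size rs = n.
Proof.
move=> /monicP p1 szp; have [rs] := closed_field_poly_normal p.
rewrite p1 scale1r => prs; exists rs => //.
by move: szp; rewrite prs size_prod_XsubC => -[].
Qed.

Lemma exists_close_root (C : numClosedFieldType) (p : {poly C}) n z :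
  p \is monic -> size p = n.+2 ->
  exists r, root p r /\ `|z - r| ^+ n.+1 <= `|p.[z]|.
Proof.
move=> p1 szp; have [rs -> szrs] := monic_prod_roots p1 szp.
have [|r rrs] := @exists_close_factor _ rs z; first by rewrite -size_eq0 szrs.
by rewrite szrs => zr; exists r; rewrite root_prod_XsubC.
Qed.

Lemma exists_root_chain (C : numClosedFieldType) n (P : nat -> {poly C}) z0 :
  (forall k, P k \is monic /\ size (P k) = n.+2) -> root (P 0%N) z0 ->
  exists x : nat -> C, x 0%N = z0 /\
    forall k, root (P k) (x k) /\
      `|x k - x k.+1| ^+ n.+1 <= `|(P k.+1).[x k]|.
Proof.
move=> mP rz0.
have /choice [f f_root] : forall kz : nat * C, exists r,
    root (P kz.1) r /\ `|kz.2 - r| ^+ n.+1 <= `|(P kz.1).[kz.2]|.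
  by case=> k z; apply: exists_close_root; case: (mP k).
(* Iteration [j] produces the point of index [j.+1], hence a root of [P j.+1]. *)
exists (fun k => iteri k (fun j z => f (j.+1, z)) z0); split=> // k.
split; last exact: (f_root (k.+1, _)).2.
by case: k => //= k; apply: (f_root (k.+1, _)).1.
Qed.

Definition grid_index (K : realType) (N : nat) (a : K) : nat :=
  Num.truncn (a * N.+1%:R).

Lemma grid_indexP (K : realType) N (a : K) : 0 <= a ->
  (grid_index N a)%:R / N.+1%:R <= a <
    (grid_index N a)%:R / N.+1%:R + N.+1%:R^-1.
Proof.
move=> a0; rewrite -{3}[N.+1%:R^-1]mul1r -mulrDl natr1.
rewrite ler_pdivrMr ?ltr_pdivlMr ?ltr0Sn //.
by apply: truncn_itv; rewrite mulr_ge0.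
Qed.

(** At grid points near [a] the chain stays within [h] of the roots of [P a] and jumps by at most
    [h], so [dist_le_clusters] bounds its travel however fine the grid is. [N] must be large because
    each single step function has jumps. *)
Lemma grid_index_equicontinuous (C : numClosedFieldType) (K : realType) n
    (P : K -> {poly C}) (x : nat -> nat -> C) (a : K) (e : C) :
  monic_path n.+1 P ->
  (forall N k, root (P (k%:R / N.+1%:R)) (x N k) /\
      `|x N k - x N k.+1| ^+ n.+1 <= `|(P (k.+1%:R / N.+1%:R)).[x N k]|) ->
  0 <= a -> 0 < e ->
  \forall b \near a & N \near \oo, 0 <= b ->
    `|x N (grid_index N a) - x N (grid_index N b)| < e.
Proof.
move=> mP xP a0 e0; have [mPa szPa] := mP.1 a.
have [rs Pars szrs] := monic_prod_roots mPa szPa.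
(* There are [n.+1] clusters, so the travel is at most [3 * n.+1] times [h]; the extra successor
   makes this less than [e]. *)
pose h := e / (3 * n.+1).+1%:R.
have h0 : 0 < h by rewrite divr_gt0.
have hn0 : 0 < h ^+ n.+1 by rewrite exprn_gt0.
(* Taking [c = a] gives closeness to the roots of [P a]; taking for [c] the next grid point gives
   small jumps. *)
have [d d0 Pd] : exists2 d : K, 0 < d & forall b c, `|a - b| < d ->
    `|a - c| < d -> forall z, root (P b) z -> `|(P c).[z]| < h ^+ n.+1.
  have [[A B] /= [nA nB] AB] := near_root_horner a mP hn0.
  have [d /= d0 dAB] := (nbhs_ballP _ _).1 (filterI nA nB).
  by exists d => // b c /dAB[Ab _] /dAB[_ Bc]; apply: (AB (b, c)).
have lt_root (t : C) : 0 <= t -> t ^+ n.+1 < h ^+ n.+1 -> t <= h.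
  by move=> t0; rewrite ltr_pXn2r ?nnegrE ?(ltW h0) // => /ltW.
have chain N u v : (u <= v)%N ->
    (forall k, (u <= k <= v)%N -> `|a - k%:R / N.+1%:R| < d) ->
    `|x N v - x N u| < e.
  move=> uv near_a; apply: (@le_lt_trans _ _ (h *+ (3 * size rs))).
    apply: dist_le_clusters => // k /andP[uk kv].
      have [|r rrs xr] := @exists_close_factor _ rs (x N k).
        by rewrite -size_eq0 szrs.
      exists r => //; apply: lt_root => //; rewrite -szrs.
      rewrite (le_lt_trans xr) // -Pars szrs.
      apply: Pd (xP N k).1; last by rewrite subrr normr0.
      by rewrite near_a // uk.
    rewrite distrC; apply: lt_root => //; rewrite (le_lt_trans (xP N k).2) //.
    by apply: Pd (xP N k).1; rewrite near_a // ?uk ?kv ?(ltnW kv) // leqW.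
  rewrite szrs -mulr_natr /h -mulrA gtr_pMr // mulrC ltr_pdivrMr // mul1r.
  by rewrite ltr_nat.
near=> b N => /= b0.
pose u k : K := k%:R / N.+1%:R.
have /andP[ga_le ga_lt] := grid_indexP N a0; rewrite -/(u _) in ga_le ga_lt.
have /andP[gb_le gb_lt] := grid_indexP N b0; rewrite -/(u _) in gb_le gb_lt.
(* One half of [d] is for the distance from [a] to [b], the other for the distance of a point to its
   grid point. *)
have bd : `|a - b| < d / 2.
  by near: b; apply: nbhsx_ballx; rewrite divr_gt0.
have Nd : N.+1%:R^-1 < d / 2.
  near: N; have d20 : 0 < d / 2 by rewrite divr_gt0.
  exact: (near_infty_natSinv_lt (PosNum d20)).
move: bd; rewrite ltr_norml => /andP[bd1 bd2].
have le_u k l : (k <= l)%N -> u k <= u l.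
  by move=> kl; rewrite ler_pM2r ?invr_gt0 // ler_nat.
have {}ga_lt : a < u (grid_index N a) + d / 2
  by rewrite (lt_trans ga_lt) ?ltrD2l.
have {}gb_lt : b < u (grid_index N b) + d / 2
  by rewrite (lt_trans gb_lt) ?ltrD2l.
have [ab|/ltnW ba] := leqP (grid_index N a) (grid_index N b).
  rewrite distrC; apply: chain => // k /andP[/le_u uk /le_u kv].
  by rewrite -/(u k) ltr_norml; apply/andP; split; lra.
apply: chain => // k /andP[/le_u uk /le_u kv].
by rewrite -/(u k) ltr_norml; apply/andP; split; lra.
Unshelve. all: by end_near. Qed.

(** * Limits of root chains along an ultrafilter *)

Lemma continuous_max0 (K : realType) : continuous (fun a : K => Num.max a 0).
Proof.
apply: (@max_fun_continuous _ K K id (cst 0)); first by move=> a; exact: cvg_id.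
exact: cst_continuous.
Qed.

(** If no root were a limit, the ultrafilter would contain, for each root, the indices at which [x]
    avoids some disc around it. These finitely many sets meet in a member of [U], on which [p]
    cannot be small. *)
Lemma ultra_root_limit (C : numClosedFieldType) n (p : {poly C})
    (U : set_system nat) (x : nat -> C) :
  UltraFilter U -> p \is monic -> size p = n.+1 ->
  (forall e, 0 < e -> \forall N \near U, `|p.[x N]| < e) ->
  exists r, root p r /\ forall e, 0 < e -> \forall N \near U, `|x N - r| < e.
Proof.
move=> UU mp szp px0; have [rs prs _] := monic_prod_roots mp szp.
apply: contrapT => nolim.
have /choice[e e_far] : forall r, exists e, r \in rs ->
    0 < e /\ \forall N \near U, ~ `|x N - r| < e.
  move=> r; apply: contrapT => noe; apply: nolim; exists r.
  have [rrs|rrs] := boolP (r \in rs); last first.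
    by case: noe; exists 0 => /(negP rrs).
  split=> [|e e0]; first by rewrite prs root_prod_XsubC.
  have [//|farU] := in_ultra_setVsetC [set N | `|x N - r| < e] UU.
  by case: noe; exists e.
(* Staying at distance [e r] from every root [r] bounds [p] away from 0. *)
have eprod0 : 0 < \prod_(r <- rs) e r.
  by rewrite big_seq prodr_gt0 // => r /e_far[].
have farU : \forall N \near U, all (fun r => e r <= `|x N - r|) rs.
  elim: rs {prs eprod0} e_far => [|r rs IHrs] e_far; first exact: nearW.
  have [e0 far_r] := e_far r (mem_head _ _).
  have far_rs := IHrs (fun r' rrs => e_far r' (mem_behead (s := r :: rs) rrs)).
  apply: filterS2 far_r far_rs => N /negP.
  rewrite -real_leNgt ?normr_real ?gtr0_real //; by move=> /= -> ->.
have : \forall N \near U, False.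
  apply: filterS2 farU (px0 _ eprod0) => N /allP far.
  rewrite prs horner_prod_XsubC normr_prod.
  rewrite real_ltNge ?(gtr0_real eprod0) //; last first.
    by rewrite ger0_real // prodr_ge0.
  rewrite big_seq [X in _ <= X]big_seq ler_prod // => r rrs.
  by rewrite far // ltW //; have [] := e_far r rrs.
by case/filter_ex.
Qed.

Lemma norm_lt_eps (F : numDomainType) (z : F) :
  (forall e, 0 < e -> `|z| < e) -> z = 0.
Proof.
move=> small; apply/eqP; apply: contraTT isT => z0.
by have := small `|z|; rewrite normr_gt0 ltxx; apply.
Qed.

Lemma grid_cvg (K : realType) (a : K) : 0 <= a ->
  (grid_index N a)%:R / N.+1%:R @[N --> \oo] --> a.
Proof.
move=> a0; apply/cvgrPdist_lt => e e0.
near=> N; have /andP[] := grid_indexP N a0.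
have : N.+1%:R^-1 < e by near: N; exact: (near_infty_natSinv_lt (PosNum e0)).
set u := _ / _; set i := _^-1 => lte ua au.
rewrite ger0_norm ?subr_ge0 // ltrBlDl (lt_trans au) // ltrD2l.
Unshelve. all: by end_near. Qed.

Lemma exists_root_path (C : numClosedFieldType) (K : realType) n
    (P : K -> {poly C}) (z0 : C) :
  monic_path n.+1 P -> root (P 0) z0 ->
  exists gamma : K -> C, [/\ continuous gamma, gamma 0 = z0 &
    forall a, 0 <= a -> root (P a) (gamma a)].
Proof.
move=> mP rz0.
have /choice[x xP] : forall N, exists x : nat -> C, x 0%N = z0 /\
    forall k, root (P (k%:R / N.+1%:R)) (x k) /\
      `|x k - x k.+1| ^+ n.+1 <= `|(P (k.+1%:R / N.+1%:R)).[x k]|.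
  move=> N; apply: (@exists_root_chain _ _ (fun k => P (k%:R / N.+1%:R))).
    by move=> k; exact: mP.1.
  by rewrite mul0r.
(* A single ultrafilter serves all [a], so that values of [gamma] at two points can be compared at a
   common index [N]. *)
have [U [UU ooU]] := ultraFilterLemma eventually_filter.
pose X N (a : K) := x N (grid_index N a).
have /choice[gamma gammaP] : forall a : K, exists r, 0 <= a ->
    root (P a) r /\ forall e, 0 < e -> \forall N \near U, `|X N a - r| < e.
  move=> a; have [a0|] := boolP (0 <= a); last by exists 0.
  have [mPa szPa] := mP.1 a.
  have [|r rP] := @ultra_root_limit C n.+1 (P a) U (X^~ a) _ mPa szPa.
    move=> e e0; apply: ooU.
    have [[A B] /= [nA nB] AB] := near_root_horner a mP e0.
    have gA : \forall N \near \oo, A ((grid_index N a)%:R / N.+1%:R).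
      exact: grid_cvg a0 _ nA.
    apply: filterS gA => N Ag.
    apply: (AB (_, a)) ((xP N).2 _).1; split=> //=.
    exact: nbhs_singleton nB.
  by exists r.
(* The path is frozen at its initial value for negative [a], which makes it continuous on the whole
   line. *)
exists (fun a => gamma (Num.max a 0)); split.
- move=> a; apply/cvgrPdist_lt => e e0.
  have m0 : 0 <= Num.max a 0 by rewrite le_max lexx orbT.
  have e30 : 0 < e / 3 by rewrite divr_gt0.
  have [[A B] /= [nA nB] AB] :=
    grid_index_equicontinuous mP (fun N => (xP N).2) m0 e30.
  have mA : \forall b \near a, A (Num.max b 0) by exact: continuous_max0 nA.
  apply: filterS mA => b Ab.
  have mb0 : 0 <= Num.max b 0 by rewrite le_max lexx orbT.
  have [N [[BN aN] bN]] := filter_ex (filterI (filterI (ooU _ nB)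
    ((gammaP _ m0).2 _ e30)) ((gammaP _ mb0).2 _ e30)).
  have ab := AB (_, N) (conj Ab BN) mb0.
  rewrite -(subrKA (X N (Num.max a 0))) (le_lt_trans (ler_normD _ _)) //.
  have -> : e = e / 3 + (e / 3 + e / 3) by field.
  rewrite distrC ltrD // -(subrKA (X N (Num.max b 0))).
  by rewrite (le_lt_trans (ler_normD _ _)) // ltrD.
(* Every chain starts at [z0] and the grid index of 0 is 0, so the limit there is [z0]. *)
- rewrite maxxx; apply/esym/subr0_eq/norm_lt_eps => e e0.
  have [N] := filter_ex ((gammaP 0 (lexx _)).2 e e0).
  by rewrite /X /grid_index mul0r truncn0 (xP N).1.
- by move=> a a0; rewrite max_l //; have [] := gammaP a a0.
Qed.

(** * Splitting off a root path and induction on the degree *)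

(** Synthetic division, from the top coefficient downwards: the constant remainder does not affect
    the coefficient of index [k.+1]. *)
Lemma coef_divp_XsubC (F : fieldType) (p : {poly F}) c k :
  (p %/ ('X - c%:P))`_k = p`_k.+1 + (p %/ ('X - c%:P))`_k.+1 * c.
Proof.
rewrite {2}[p](divp_eq p ('X - c%:P)) coefD mulrBr coefB coefMX coefMC /=.
rewrite [X in _ + X + _]nth_default ?addr0 ?subrK //.
have : (size (p %% ('X - c%:P))%R < size ('X - c%:P)%R)%N.
  by rewrite ltn_modp polyXsubC_eq0.
by rewrite size_XsubC ltnS => /leq_trans; apply.
Qed.

Lemma monic_path_divp (C : numFieldType) (K : topologicalType) n
    (P : K -> {poly C}) (gamma : K -> C) :
  monic_path n.+1 P -> continuous gamma ->
  monic_path n (fun a => P a %/ ('X - (gamma a)%:P)).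
Proof.
move=> [mP cP] cgamma.
have szS a : size (P a %/ ('X - (gamma a)%:P)) = n.+1.
  by rewrite size_divp ?polyXsubC_eq0 // size_XsubC (mP a).2 subn1.
split=> [a|].
  split=> //; apply/monicP; rewrite lead_coefE szS /= coef_divp_XsubC.
  rewrite [X in _ + X * _]nth_default ?szS // mul0r addr0.
  by have [/monicP + szP] := mP a; rewrite lead_coefE szP.
(* Descending induction on [k], from the vanishing coefficients of index at least [n.+1]: each
   coefficient depends continuously on the next higher one. *)
move=> k; have [m] := ubnP (n.+1 - k); elim: m k => // m IHm k km.
have [nk|kn] := leqP n.+1 k.
  rewrite (_ : (fun _ => _) = cst 0); first exact: cst_continuous.
  by apply/funext => a; rewrite nth_default ?szS.
under eq_fun do rewrite coef_divp_XsubC.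
have cS : continuous (fun a => (P a %/ ('X - (gamma a)%:P))`_k.+1).
  by apply: IHm; lia.
by move=> a; apply: cvgD; [exact: cP|apply: cvgM; [exact: cS|exact: cgamma]].
Qed.

Lemma exists_root_paths (C : numClosedFieldType) (K : realType) n
    (P : K -> {poly C}) (z : 'I_n -> C) :
  monic_path n P -> P 0 = \prod_j ('X - (z j)%:P) ->
  exists gamma : 'I_n -> K -> C,
    [/\ forall j, continuous (gamma j), forall j, gamma j 0 = z j &
        forall a, 0 <= a -> P a = \prod_j ('X - (gamma j a)%:P)].
Proof.
elim: n P z => [|n IHn] P z mP P0.
  exists (fun _ _ => 0); split=> [[]//|[]//|a _]; rewrite big_ord0.
  have [/monicP + szP] := mP.1 a; rewrite lead_coefE szP /=.
  by rewrite [P a]size1_polyC ?szP // coefC /= => ->.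
move: P0; rewrite big_ord_recl => P0.
have [|gamma [cgamma gamma0 Pgamma]] := exists_root_path (z0 := z ord0) mP.
  by rewrite P0 rootM root_XsubC eqxx.
have [|Gamma [cGamma Gamma0 SGamma]] := IHn _ (fun j => z (lift ord0 j))
  (monic_path_divp mP cgamma).
  by rewrite gamma0 P0 mulKp // polyXsubC_eq0.
exists (fun j a => if unlift ord0 j is Some k then Gamma k a else gamma a).
split=> [j|j|a a0].
- by case: (unlift ord0 j).
- by case: unliftP => [k|] ->.
- rewrite big_ord_recl unlift_none.
  under eq_bigr do rewrite liftK.
  (* The division is exact because [gamma a] is a root, which is known for [0 <= a]. *)
  by rewrite -SGamma // mulrC divpK // -root_factor_theorem Pgamma.
Qed.

(** * Continuation of root paths from the unit interval to the line *)

Lemma monic_path_comp (C : numFieldType) (K K' : topologicalType) n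
    (P : K -> {poly C}) (h : K' -> K) :
  monic_path n P -> continuous h -> monic_path n (P \o h).
Proof.
move=> [mP cP] ch; split=> [a|k a]; first exact: mP.
exact: continuous_comp (ch a) (cP k (h a)).
Qed.

(** The retraction of the line onto the unit interval; composing with it turns continuity within
    [[0, 1]] into continuity everywhere. *)
Definition clamp01 (K : realType) (a : K) := Num.max (Num.min a 1) 0.

Lemma clamp01_in (K : realType) (a : K) : clamp01 a \in `[0, 1].
Proof.
by rewrite in_itv /= le_max lexx orbT ge_max ge_min lexx orbT ler01.
Qed.

Lemma clamp01_id (K : realType) (a : K) : a \in `[0, 1] -> clamp01 a = a.
Proof.
by rewrite /clamp01 in_itv /= => /andP[a0 a1]; rewrite min_l // max_l.
Qed.

Lemma continuous_clamp01 (K : realType) : continuous (@clamp01 K).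
Proof.
apply: (@max_fun_continuous _ K K _ (cst 0)); last exact: cst_continuous.
apply: (@min_fun_continuous _ K K id (cst 1)); last exact: cst_continuous.
by move=> a; exact: cvg_id.
Qed.

Lemma continuous_comp_clamp01 (K : realType) (T : topologicalType)
    (gamma : K -> T) :
  {within `[0, 1], continuous gamma} -> continuous (gamma \o @clamp01 K).
Proof.
move=> /subspace_continuousP cgamma a V nV.
have nW := cgamma _ (clamp01_in a) _ nV.
have mW : \forall b \near a, clamp01 b \in `[0, 1] -> V (gamma (clamp01 b)).
  exact: continuous_clamp01 nW.
by apply: filterS mW => b; apply; exact: clamp01_in.
Qed.

(** Root paths can start from any labelling of the roots, so those leaving 0 to the left and 1 to
    the right can be made to begin at the ends of the given [gamma j]. Adding up increments glues
    the three pieces continuously. *)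
Lemma extend_root_paths (C : numClosedFieldType) (K : realType) n
    (P : K -> {poly C}) (gamma : 'I_n -> K -> C) :
  monic_path n P ->
  (forall j, {within `[0, 1], continuous (gamma j)}) ->
  (forall a, a \in `[0, 1] -> P a = \prod_j ('X - (gamma j a)%:P)) ->
  exists Gamma : 'I_n -> K -> C,
    [/\ forall j, continuous (Gamma j),
        forall a, P a = \prod_j ('X - (Gamma j a)%:P) &
        forall j a, a \in `[0, 1] -> Gamma j a = gamma j a].
Proof.
move=> mP cgamma Pgamma.
have I0 : (0 : K) \in `[0, 1] by rewrite in_itv /= lexx ler01.
have I1 : (1 : K) \in `[0, 1] by rewrite in_itv /= lexx ler01.
have c0 (c : K) : continuous (fun a : K => a - c).
  move=> a; apply: (@cvgB K _ _ _ _ id (cst c)); first exact: cvg_id.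
  exact: cvg_cst.
have copp : continuous (fun a : K => - a).
  by move=> a; apply: (@cvgN K _ _ _ _ id); exact: cvg_id.
have cadd1 : continuous (fun a : K => 1 + a).
  move=> a; apply: (@cvgD K K _ _ _ (cst (1 : K)) id); first exact: cvg_cst.
  exact: cvg_id.
(* [l] follows the roots leftwards from 0 along [P (- a)], and [r] rightwards from 1 along
   [P (1 + a)]. *)
have [|l [cl l0 Pl]] := exists_root_paths (z := fun j => gamma j 0)
    (monic_path_comp mP copp).
  by rewrite /= oppr0 Pgamma.
have [|r [cr r0 Pr]] := exists_root_paths (z := fun j => gamma j 1)
    (monic_path_comp mP cadd1).
  by rewrite /= addr0 Pgamma.
(* The second summand vanishes for [0 <= a], the third for [a <= 1]. *)
pose Gamma j a := gamma j (clamp01 a) + (l j (Num.max (- a) 0) - gamma j 0)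
  + (r j (Num.max (a - 1) 0) - gamma j 1).
have Gamma_in j a : a \in `[0, 1] -> Gamma j a = gamma j a.
  move=> aI; move: (aI); rewrite in_itv /= => /andP[a0 a1].
  rewrite /Gamma clamp01_id // !max_r ?oppr_le0 ?subr_le0 // l0 r0.
  by rewrite !subrr !addr0.
exists Gamma; split=> [j a|a|//].
  apply: cvgD; [apply: cvgD|].
  - exact: (continuous_comp_clamp01 (cgamma j)).
  - apply: cvgB; last exact: cvg_cst.
    exact: continuous_comp
      (continuous_comp (copp a) (@continuous_max0 _ _)) (cl _ _).
  - apply: cvgB; last exact: cvg_cst.
    exact: continuous_comp
      (continuous_comp (c0 1 a) (@continuous_max0 _ _)) (cr _ _).
have [a0|a0] := ltP a 0.
  have /= := Pl (- a); rewrite opprK oppr_ge0 ltW // => -> //.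
  apply: eq_bigr => j _.
  rewrite /Gamma /clamp01 min_l ?(le_trans (ltW a0)) // max_r ?ltW //.
  rewrite max_l ?oppr_ge0 ?ltW // max_r ?r0 ?subrr ?addr0 ?subrKC //.
  by rewrite subr_le0 (le_trans (ltW a0)).
have [a1|a1] := leP a 1.
  rewrite Pgamma ?in_itv /= ?a0 //; apply: eq_bigr => j _.
  by rewrite Gamma_in // in_itv /= a0.
have /= := Pr (a - 1); rewrite subrKC subr_ge0 ltW // => -> //.
apply: eq_bigr => j _.
rewrite /Gamma /clamp01 min_r ?ltW // (max_l ler01) max_r ?oppr_le0 //.
by rewrite l0 subrr addr0 max_l ?subr_ge0 ?ltW // subrKC.
Qed.

(** * Root multisets and the line through [Q] and [R] *)

(** By unique factorization, [Sigma] does not depend on the chosen sequence of roots. *)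
Lemma Sigma_prod_XsubC (K : realType) (rs : seq K[i]) :
  Sigma (\prod_(r <- rs) ('X - r%:P)) = seq_mset rs.
Proof.
rewrite /Sigma; case: closed_field_poly_normal => s /=.
by rewrite lead_coef_prod_XsubC scale1r => /prod_XsubC_eq/eq_seq_msetP.
Qed.

Lemma monic_eq_prod_Sigma (K : realType) (P : {poly K[i]}) (rs : seq K[i]) :
  P \is monic -> Sigma P = seq_mset rs -> P = \prod_(r <- rs) ('X - r%:P).
Proof.
move=> /monicP P1; rewrite /Sigma; case: closed_field_poly_normal => s /=.
by rewrite P1 scale1r => {1}-> /eq_seq_msetP; exact: perm_big.
Qed.

Lemma continuous_real_complex (K : realType) :
  continuous (fun a : K => a%:C : K[i]^o).
Proof.
move=> a; apply/cvgrPdist_lt => e e0.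
(* A positive element of [K[i]] is real, so [e] can be replaced by its real part. *)
have eRe : (complex.Re e)%:C = e by rewrite RRe_real // gtr0_real.
have Re0 : 0 < complex.Re e by rewrite -ltcR eRe.
near=> b; rewrite -eRe -rmorphB normc_def /= expr0n addr0 sqrtr_sqr ltcR.
by near: b; exact: cvgr_dist_lt.
Unshelve. all: by end_near. Qed.

Lemma convex_pathE (K : realType) (Q R : {poly K[i]}) (a b : K) :
  a + b = 1 -> a%:C *: Q + b%:C *: R = convex_path Q R b.
Proof. by move=> ab; rewrite /convex_path -ab addrK. Qed.

Lemma continuous_lincomb (C : numFieldType) (T : topologicalType)
    (u v : T -> C) (c d : C) : continuous u -> continuous v ->
  continuous (fun a => u a * c + v a * d).
Proof.
move=> cu cv a; apply: cvgD; apply: cvgM; try exact: cvg_cst.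
  exact: cu.
exact: cv.
Qed.

(** The coefficient of index [n] is [(1 - a) + a = 1] for every real [a], also outside [[0, 1]],
    where [g] may take values. *)
Lemma monic_path_convex (K : realType) n (Q R : {poly K[i]}) :
  monic_deg n Q -> monic_deg n R ->
  @monic_path K[i] K n (convex_path Q R).
Proof.
move=> [/monicP mQ szQ] [/monicP mR szR]; split=> [a|k].
  have coefn : (convex_path Q R a)`_n = 1.
    rewrite coefD !coefZ; move: mQ mR; rewrite !lead_coefE szQ szR /= => -> ->.
    by rewrite !mulr1 -rmorphD /= subrK.
  have sz : size (convex_path Q R a) = n.+1.
    apply/eqP; rewrite eqn_leq; apply/andP; split.
      rewrite (leq_trans (size_polyD _ _)) // geq_max.
      by rewrite -{1}szQ -szR !size_scale_leq.
    rewrite ltnNge; apply/negP => /leq_sizeP/(_ n (leqnn n))/eqP.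
    by rewrite coefn oner_eq0.
  by split=> //; apply/monicP; rewrite lead_coefE sz.
under eq_fun do rewrite coefD !coefZ.
apply: (@continuous_lincomb K[i] K (fun a => (1 - a)%:C) (fun a => a%:C)).
  have c1 : continuous (fun b : K => 1 - b).
    move=> b; apply: (@cvgB K K _ _ _ (cst (1 : K)) id); last exact: cvg_id.
    exact: cvg_cst.
  by move=> a; exact: continuous_comp (c1 a) (@continuous_real_complex K _).
exact: continuous_real_complex.
Qed.

Theorem theorem7 (K : realType) (n : nat) (Q R : {poly K[i]})
    (hQ : monic_deg n Q) (hR : monic_deg n R) (f g : K -> K)
    (hf : {within `[0, 1], continuous f})
    (hg : {within `[0, 1], continuous g})
    (f0 : f 0 = 1) (g1 : g 1 = 1) (f1 : f 1 = 0) (g0 : g 0 = 0)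
    (hP : poly_path_from_to n
            (fun a : K => (f a)%:C *: Q + (g a)%:C *: R) Q R)
    (hmax : forall a : K, a \in `[0, 1] -> 0 <= Num.max (f a) (g a))
    (p : copies (Sigma Q) -> copies (Sigma R))
    (hp : convex_root_pairing n p) :
  root_pairing n (fun a : K => (f a)%:C *: Q + (g a)%:C *: R) p.
Proof.
have mL := monic_path_convex hQ hR.
have [_ bij_p [gamma [[cgamma Sgamma] [s [t [bij_s bij_t st]]]]]] := hp.
have fg a : a \in `[0, 1] -> f a + g a = 1.
  move=> aI; have [[mP _] _ _] := hP; have [/monicP] := mP a aI.
  rewrite lead_coefE => + szP; rewrite szP /= coefD !coefZ.
  have [/monicP + szQ] := hQ; have [/monicP + szR] := hR.
  rewrite !lead_coefE szQ szR /= => -> ->; rewrite !mulr1 -rmorphD /=.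
  by move/complexI.
(* Equality of root multisets becomes a factorization, the form in which root paths are
   continued. *)
have Lgamma a : a \in `[0, 1] ->
    convex_path Q R a = \prod_j ('X - (gamma j a)%:P).
  move=> aI; have := monic_eq_prod_Sigma (mL.1 a).1 (Sgamma a aI).
  by rewrite big_image.
have [Gamma [cGamma LGamma Gamma_in]] :=
  @extend_root_paths K[i] K n _ gamma mL cgamma Lgamma.
split=> //; exists (fun j => Gamma j \o g); split.
  split=> [j|a aI].
    move=> a; exact: continuous_comp (hg a) (cGamma j (g a)).
  rewrite convex_pathE ?fg // LGamma.
  rewrite -(big_image _ _ (fun j => Gamma j (g a)) _ (fun z => 'X - z%:P)).
  exact: Sigma_prod_XsubC.
(* As [g] fixes 0 and 1, the identifications [s] and [t] of the endpoints can be kept. *)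
exists s, t; split=> // j; have [s0 t1 pst] := st j.
by split=> //=; rewrite ?g0 ?g1 Gamma_in // in_itv /= lexx ler01.
Qed.
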